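(* Let $\mu=g\,dx$ be a finite Borel measure on $\mathbb{R}^d$ that is absolutely continuous with respect to Lebesgue measure, with density $g\ge 0$. If $\nu$ is a frame measure for $\mu$ with frame bounds $A,B>0$, then $$\frac{B}{A}\geq\frac{\operatorname{ess\,sup}_\mu(g)}{\operatorname{ess\,inf}_\mu(g)}.$$ In particular, if $\operatorname{ess\,sup}_\mu(g)=\infty$ or $\operatorname{ess\,inf}_\mu(g)=0$, then $\mu$ admits no frame measure.
   Context: A Borel measure $\nu$ on $\mathbb{R}^d$ is a frame measure for $\mu$ with frame bounds $A,B>0$ if $A\|f\|_{L^2(\mu)}^2\le \|\widehat{f\,d\mu}\|_{L^2(\nu)}^2\le B\|f\|_{L^2(\mu)}^2$ for all $f\in L^2(\mu)$, where $\widehat{f\,d\mu}(t)=\int f(x)e^{-2\pi i t\cdot x}\,d\mu(x)$. For a nonnegative Borel function $f$: $\operatorname{ess\,sup}_\mu(f)=\inf\{M\in[0,\infty]: f\le M\ \mu\text{-a.e.}\}$ and $\operatorname{ess\,inf}_\mu(f)=\sup\{m\ge 0: f\ge m\ \mu\text{-a.e.}\}$. *)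

(* Defs.v *)
From HB Require Import structures.
From mathcomp Require Import all_boot all_order all_algebra.
From mathcomp Require Import all_classical all_reals all_analysis.
Set Implicit Arguments. Unset Strict Implicit. Unset Printing Implicit Defensive.
Import Order.TTheory GRing.Theory Num.Theory.
Import numFieldNormedType.Exports.
Local Open Scope classical_set_scope.
Local Open Scope ring_scope.

Definition open_box (R : realType) (d : nat) (a b : 'rV[R]_d) : set 'rV[R]_d :=
  [set x | forall i : 'I_d, a ord0 i < x ord0 i < b ord0 i].

Definition open_boxes (R : realType) (d : nat) : set (set 'rV[R]_d) :=
  [set B | exists a b, B = open_box a b].

(* R^d with its Borel sigma-algebra (generated by the open boxes). *)
Definition Rd (R : realType) (d : nat) := g_sigma_algebraType (@open_boxes R d).

(* Lebesgue measure on the Borel sets of R^d: a measure giving every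
   nondegenerate open box its volume (this determines it uniquely). *)
Definition is_lebesgue_measure (R : realType) (d : nat)
    (lam : {measure set Rd R d -> \bar R}) : Prop :=
  forall a b : 'rV[R]_d, (forall i, a ord0 i <= b ord0 i) ->
    lam (open_box a b) = (\prod_(i < d) (b ord0 i - a ord0 i))%:E.

Definition dotR (R : realType) (d : nat) (t x : 'rV[R]_d) : R :=
  \sum_(i < d) t ord0 i * x ord0 i.

Definition esssup (R : realType) (d : nat) (mu : {measure set Rd R d -> \bar R})
    (f : Rd R d -> R) : \bar R :=
  ereal_inf [set M : \bar R | (0 <= M)%E /\ {ae mu, forall x, ((f x)%:E <= M)%E}].

Definition essinf (R : realType) (d : nat) (mu : {measure set Rd R d -> \bar R})
    (f : Rd R d -> R) : \bar R :=
  ereal_sup [set m : \bar R | (0 <= m)%E /\ {ae mu, forall x, (m <= (f x)%:E)%E}].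

(* A complex-valued f = u + i v is in L^2(mu) iff u, v are measurable
   and square integrable. *)
Definition L2 (R : realType) (d : nat) (mu : {measure set Rd R d -> \bar R})
    (u : Rd R d -> R) : Prop :=
  measurable_fun [set: Rd R d] u /\
  (\int[mu]_x ((u x) ^+ 2)%:E < +oo)%E.

Definition L2norm2 (R : realType) (d : nat) (mu : {measure set Rd R d -> \bar R})
    (u v : Rd R d -> R) : \bar R :=
  (\int[mu]_x ((u x) ^+ 2 + (v x) ^+ 2)%:E)%E.

(* Fourier transform of (u + i v) dmu at t:
   int (u + i v)(x) (cos(2 pi t.x) - i sin(2 pi t.x)) dmu(x). *)
Definition FT_re (R : realType) (d : nat) (mu : {measure set Rd R d -> \bar R})
    (u v : Rd R d -> R) (t : 'rV[R]_d) : R :=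
  \int[mu]_x (u x * cos (2 * pi * dotR t x) + v x * sin (2 * pi * dotR t x)).

Definition FT_im (R : realType) (d : nat) (mu : {measure set Rd R d -> \bar R})
    (u v : Rd R d -> R) (t : 'rV[R]_d) : R :=
  \int[mu]_x (v x * cos (2 * pi * dotR t x) - u x * sin (2 * pi * dotR t x)).

Definition frame_measure (R : realType) (d : nat)
    (mu nu : {measure set Rd R d -> \bar R}) (A B : R) : Prop :=
  0 < A /\ 0 < B /\
  forall u v : Rd R d -> R, L2 mu u -> L2 mu v ->
    (A%:E * L2norm2 mu u v <=
       \int[nu]_t ((FT_re mu u v t) ^+ 2 + (FT_im mu u v t) ^+ 2)%:E <=
     B%:E * L2norm2 mu u v)%E.

(* Main.v *)
Require Import Defs.
From HB Require Import structures.
From mathcomp Require Import all_boot all_order all_algebra.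
From mathcomp Require Import all_classical all_reals all_analysis.
From mathcomp Require Import measurable_realfun ring lra.
Import Order.TTheory GRing.Theory Num.Theory.
Import numFieldNormedType.Exports.
Local Open Scope classical_set_scope.
Local Open Scope ring_scope.

Set Implicit Arguments.
Unset Strict Implicit.
Unset Printing Implicit Defensive.

(** If [F] is a set of positive measure where [0 < g < m] and whose translate
    [F + a] lies in [{g > M}], then [f = 1_F] and
    [f'(y) = 1_F(y - a) g(y - a) / g(y)] satisfy: [f' dmu] is the translate of
    [f dmu], so both Fourier transforms have the same modulus everywhere, while
    [||f'||^2 <= (m / M) ||f||^2].  The two frame inequalities then give
    [A M <= B m].  Such an [a] exists for all [M < esssup g] and
    [m > essinf g], because by Tonelli the integral over [a] of
    [lam {x in F | x + a in E}] is [lam E * lam F]. *)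

(** * Borel sets and measurable maps of [R^d] *)

Lemma measurable_open_box (R : realType) (d : nat) (a b : 'rV[R]_d) :
  measurable (open_box a b : set (Rd R d)).
Proof. by apply: sub_sigma_algebra; exists a, b. Qed.

Lemma bounded_row (R : realType) (d : nat) (x : 'rV[R]_d) :
  exists n : nat, forall i, - n%:R < x ord0 i < n%:R.
Proof.
exists (\max_(i < d) (Num.truncn `|x ord0 i|).+1)%N => i.
rewrite -ltr_norml (lt_le_trans (truncnS_gt _))// ler_nat.
exact: (@leq_bigmax _ (fun i => (Num.truncn `|x ord0 i|).+1)).
Qed.

(** A countable exhaustion by boxes of finite volume, used both for sigma-finiteness and for the
    uniqueness of measures agreeing on boxes. *)
Definition cube (R : realType) (d : nat) (n : nat) : set 'rV[R]_d :=
  open_box (const_mx (- n%:R)) (const_mx n%:R).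

Lemma bigcup_cube (R : realType) (d : nat) : \bigcup_n @cube R d n = setT.
Proof.
apply/seteqP; split => // x _; have [n nx] := bounded_row x.
by exists n => // i; rewrite !mxE.
Qed.

Lemma measurable_coord (R : realType) (d : nat) (i : 'I_d) :
  measurable_fun [set: Rd R d] (fun x : Rd R d => (x : 'rV[R]_d) ord0 i).
Proof.
apply: (measurability _ (RGenOInfty.measurableE R)) => _ [_ [c ->] <-].
rewrite setTI.
(* The half-space [c < x_i] is the union over [n] of the boxes with lower corner [lo n] and all
   upper coordinates [n]. *)
pose lo n : 'rV[R]_d := \row_j (if j == i then c else - n%:R).
rewrite (_ : _ @^-1` _ = \bigcup_n
    (open_box (lo n) (const_mx n%:R) : set (Rd R d))).
  by apply: bigcupT_measurable => n; exact: measurable_open_box.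
apply/seteqP; split => x /=.
  rewrite in_itv/= andbT => cx; have [n nx] := bounded_row x.
  exists n => // j; rewrite !mxE; case: eqP => [->|_]; last exact: nx.
  by rewrite cx; have /andP[] := nx i.
by move=> [n _ /(_ i)]; rewrite !mxE eqxx in_itv/= andbT => /andP[].
Qed.

(** Boxes generate the sigma-algebra, and the preimage of a box is a finite intersection of
    preimages of intervals under the coordinates. *)
Lemma measurable_fun_Rd (R : realType) (d : nat) (e : measure_display)
    (T : measurableType e) (f : T -> Rd R d) :
  (forall i, measurable_fun setT (fun t => (f t : 'rV[R]_d) ord0 i)) ->
  measurable_fun setT f.
Proof.
move=> mf.
apply: (@measurability _ _ T (Rd R d) setT f (@open_boxes R d)) => //.
move=> _ [_ [a [b ->]] <-]; rewrite setTI.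
rewrite (_ : f @^-1` _ = \bigcap_(i in [set: 'I_d])
    ((fun t => (f t : 'rV[R]_d) ord0 i) @^-1` `]a ord0 i, b ord0 i[%classic)).
  apply: fin_bigcap_measurable => // i _; rewrite -[X in measurable X]setTI.
  exact: mf.
apply/seteqP; split=> t /= h i; first by move=> _; rewrite /= in_itv; exact: h.
by have := h i I; rewrite /= in_itv.
Qed.

Lemma measurable_addRd (R : realType) (d : nat) :
  measurable_fun [set: Rd R d * Rd R d]
    (fun p => (p.1 : 'rV[R]_d) + (p.2 : 'rV[R]_d) : Rd R d).
Proof.
apply: measurable_fun_Rd => i.
under eq_fun do rewrite mxE.
by apply: measurable_funD; apply: measurableT_comp (measurable_coord i) _.
Qed.

Definition shift (R : realType) (d : nat) (a x : Rd R d) : Rd R d :=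
  (x : 'rV[R]_d) + (a : 'rV[R]_d).

Lemma measurable_shift (R : realType) (d : nat) (a : Rd R d) :
  measurable_fun [set: Rd R d] (shift a).
Proof.
apply: measurable_fun_Rd => i.
under eq_fun do rewrite mxE.
by apply: measurable_funD => //; exact: measurable_coord.
Qed.

Lemma measurable_dotR (R : realType) (d : nat) (t : 'rV[R]_d) :
  measurable_fun [set: Rd R d] (fun x : Rd R d => dotR t x).
Proof.
apply: measurable_sum => i; apply: measurable_funM => //.
exact: measurable_coord.
Qed.

(** * Lebesgue measure: sigma-finiteness and translation invariance *)

Lemma lebesgue_cube_lty (R : realType) (d : nat)
    (lam : {measure set Rd R d -> \bar R}) (n : nat) :
  is_lebesgue_measure lam -> (lam (@cube R d n) < +oo)%E.
Proof.
move=> ->; first by rewrite ltry.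
by move=> i; rewrite !mxE (@le_trans _ _ 0)// oppr_le0.
Qed.

Lemma lebesgue_sigma_finite (R : realType) (d : nat)
    (lam : {measure set Rd R d -> \bar R}) :
  is_lebesgue_measure lam -> sigma_finite [set: Rd R d] lam.
Proof.
move=> hlam; exists (@cube R d); first by rewrite bigcup_cube.
by move=> n; split; [exact: measurable_open_box|exact: lebesgue_cube_lty].
Qed.

Lemma open_boxI (R : realType) (d : nat) : setI_closed (@open_boxes R d).
Proof.
move=> _ _ [a [b ->]] [a' [b' ->]].
exists (\row_i Num.max (a ord0 i) (a' ord0 i)).
exists (\row_i Num.min (b ord0 i) (b' ord0 i)).
apply/seteqP; split=> x /=.
  move=> [h h'] i; have := h i; have := h' i.
  by rewrite !mxE gt_max lt_min => /andP[-> ->] /andP[-> ->].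
move=> h; split=> i; have := h i; rewrite !mxE gt_max lt_min.
  by move=> /andP[/andP[-> _] /andP[-> _]].
by move=> /andP[/andP[_ ->] /andP[_ ->]].
Qed.

(** [lam] and its pushforward under the shift agree on boxes, a generating pi-system exhausted by
    cubes of finite measure, hence on all Borel sets. *)
Lemma lebesgue_shift (R : realType) (d : nat)
    (lam : {measure set Rd R d -> \bar R}) (a : Rd R d) :
  is_lebesgue_measure lam ->
  forall A : set (Rd R d), measurable A -> lam (shift a @^-1` A) = lam A.
Proof.
move=> hlam A mA.
pose mshift_mixin := isMeasurableFun.Build _ _ _ _ _ (@measurable_shift R d a).
pose mshift : {mfun _ >-> _} := HB.pack (shift a) mshift_mixin.
apply/esym; rewrite -[RHS]/(pushforward lam mshift A).
apply: (@measure_unique _ R (Rd R d) (@open_boxes R d) (@cube R d)) => //.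
- exact: open_boxI.
- by move=> n; exists (const_mx (- n%:R)), (const_mx n%:R).
- by rewrite bigcup_cube.
- move=> _ [u [v ->]]; apply/esym.
  rewrite [LHS](_ : _ =
      lam (open_box (u - (a : 'rV_d)) (v - (a : 'rV_d)))); last first.
    congr (lam _); apply/seteqP; split=> x h i; have := h i;
    by rewrite !mxE ltrBlDr ltrBrDr.
  have [uv|] := pselect (forall i, u ord0 i <= v ord0 i).
    rewrite !hlam//; last by move=> i; rewrite !mxE lerD2r.
    by congr (_%:E); apply: eq_bigr => i _; rewrite !mxE; congr (_); lra.
  (* [is_lebesgue_measure] speaks only of boxes with ordered corners; a box with a reversed side is
     empty, and so is its translate. *)
  move=> /existsNP[i /negP]; rewrite -ltNge => vu.
  have empty (p q : 'rV[R]_d) : q ord0 i < p ord0 i -> open_box p q = set0.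
    move=> qp; apply/seteqP; split=> // x /(_ i) /andP[px xq].
    by have := lt_trans px (lt_trans xq qp); rewrite ltxx.
  by rewrite !empty ?measure0// !mxE ltrD2r.
- by move=> n; exact: lebesgue_cube_lty.
Qed.

(** * Integration against a density, and overlaps of translates *)

(** Turns the hypothesis of sigma-finiteness into the structure that Radon-Nikodym and Tonelli take
    as input. *)
Definition sigma_finite_pack (e : measure_display) (T : measurableType e)
    (R : realType) (lam : {measure set T -> \bar R})
    (slam : sigma_finite [set: T] lam) :
    {sigma_finite_measure set T -> \bar R} :=
  HB.pack_for {sigma_finite_measure set T -> \bar R} (Measure.sort lam)
    (isSFinite.Build _ _ _ _ (sfinite_measure_sigma_finite slam))
    (isSigmaFinite.Build _ _ _ _ slam).

(** [mu] is dominated by [lam], and its Radon-Nikodym derivative is almost everywhere [g] because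
    both have the same integral over every measurable set. *)
Lemma ge0_integral_density (e : measure_display) (T : measurableType e)
    (R : realType) (lam mu : {measure set T -> \bar R}) (g : T -> R) :
  sigma_finite [set: T] lam -> (mu [set: T] < +oo)%E ->
  measurable_fun [set: T] g -> (forall x, 0 <= g x) ->
  (forall E, measurable E -> mu E = (\int[lam]_(x in E) (g x)%:E)%E) ->
  forall f : T -> \bar R, measurable_fun [set: T] f -> (forall x, 0 <= f x)%E ->
  (\int[mu]_x f x = \int[lam]_x (f x * (g x)%:E))%E.
Proof.
move=> slam mufin mg g0 mu_g f mf f0.
pose lamS := sigma_finite_pack slam.
have fin_mu : fin_num_fun mu.
  move=> E mE; rewrite ge0_fin_numE//; apply: le_lt_trans mufin.
  by apply: le_measure => //; rewrite inE.
have smu : sigma_finite [set: T] mu.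
  by apply: fin_num_fun_sigma_finite => //; rewrite measure0.
pose muF : {finite_measure set T -> \bar R} :=
  HB.pack_for {finite_measure set T -> \bar R} (Measure.sort mu)
    (isFinite.Build _ _ _ _ fin_mu)
    (isSFinite.Build _ _ _ _ (sfinite_measure_sigma_finite smu))
    (isSigmaFinite.Build _ _ _ _ smu).
have mulam : muF `<< lamS.
  apply/null_content_dominatesP => E mE lamE0; rewrite /= mu_g//.
  apply: null_set_integral => //. exact/measurable_EFinP/measurable_funTS.
transitivity (\int[muF]_x f x)%E; first by [].
rewrite -(Radon_Nikodym_SigmaFinite.change_of_variables mulam)//.
have RN0 := Radon_Nikodym_SigmaFinite.f_ge0 mulam.
have iRN := Radon_Nikodym_SigmaFinite.f_integrable mulam.
apply: ge0_ae_eq_integral => //.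
- by apply: emeasurable_funM => //; exact: measurable_int iRN.
- by apply: emeasurable_funM => //; exact/measurable_EFinP.
- by move=> x _; rewrite mule_ge0.
- by move=> x _; rewrite mule_ge0// lee_fin.
- apply: ae_eqe_mul2l; apply: integral_ae_eq => //.
    exact/measurable_EFinP.
  move=> E _ mE; rewrite -Radon_Nikodym_SigmaFinite.f_integral//; exact: mu_g.
Qed.

Lemma exists_shift_meets (R : realType) (d : nat)
    (lam : {measure set Rd R d -> \bar R}) (E F : set (Rd R d)) :
  is_lebesgue_measure lam -> measurable E -> measurable F ->
  (0 < lam E)%E -> (0 < lam F)%E ->
  exists a, (0 < lam (F `&` shift a @^-1` E))%E.
Proof.
move=> hlam mE mF lE lF; apply: contrapT => /forallNP h.
have {}h a : lam (F `&` shift a @^-1` E) = 0%E.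
  by apply/eqP; have /negP := h a; rewrite -leNgt measure_le0.
pose lamS := sigma_finite_pack (lebesgue_sigma_finite hlam).
have mshift a : measurable (shift a @^-1` E : set (Rd R d)).
  by rewrite -[X in measurable X]setTI; exact: measurable_shift.
pose f (p : Rd R d * Rd R d) : \bar R := (\1_F p.1 * \1_E (shift p.2 p.1))%:E.
have mf : measurable_fun setT f.
  apply/measurable_EFinP; apply: measurable_funM.
    exact: measurableT_comp.
  apply: (@measurableT_comp _ _ _ _ _ _ (\1_E : Rd R d -> R)) => //.
  exact: measurable_addRd.
have f0 p : (0 <= f p)%E by rewrite lee_fin mulr_ge0.
have := @fubini_tonelli _ _ _ _ R lamS lamS f mf f0.
(* Here the translation [y] is integrated first: for fixed [x], the [y] with [x + y] in [E] form a
   translate of [E], of measure [lam E]. *)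
have -> : (\int[lamS]_x \int[lamS]_y f (x, y) = lam F * lam E)%E.
  transitivity (\int[lamS]_x (lam E * (\1_F x)%:E))%E.
    apply: eq_integral => x _.
    transitivity (\int[lamS]_y ((\1_F x)%:E * (\1_(shift x @^-1` E) y)%:E))%E.
      by apply: eq_integral => y _; rewrite /f /= EFinM /shift addrC.
    rewrite ge0_integralZl//; last exact/measurable_EFinP.
    by rewrite integral_indic// setIT muleC lebesgue_shift.
  rewrite ge0_integralZl//; last exact/measurable_EFinP.
  by rewrite integral_indic// setIT muleC.
(* In the other order each inner integral is the measure of an overlap, null by assumption. *)
have -> : (\int[lamS]_y \int[lamS]_x f (x, y) = 0)%E.
  apply: integral0_eq => a _; rewrite -(h a).
  rewrite -[F `&` _]setIT -integral_indic//; last exact: measurableI.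
  by apply: eq_integral => x _; rewrite /f/= indicI.
by move/eqP; rewrite mule_eq0 !gt_eqF.
Qed.

(** * Translating the measure [1_F dmu] *)

Lemma ge0_integral_shift (R : realType) (d : nat)
    (lam : {measure set Rd R d -> \bar R}) (a : Rd R d) (f : Rd R d -> \bar R) :
  is_lebesgue_measure lam ->
  measurable_fun [set: Rd R d] f -> (forall x, 0 <= f x)%E ->
  (\int[lam]_x f (shift a x) = \int[lam]_x f x)%E.
Proof.
move=> hlam mf f0.
have mshift := @measurable_shift R d a.
rewrite -[LHS]/(\int[lam]_(x in shift a @^-1` setT) (f \o shift a) x)%E.
rewrite -(ge0_integral_pushforward mshift)//.
by apply: eq_measure_integral => A mA _; exact: (lebesgue_shift a hlam).
Qed.

(** On nonnegative reals the inverse is the real power of exponent [-1], including the value [0] at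
    [0], and real powers are measurable. *)
Lemma measurable_inv_ge0 (e : measure_display) (T : measurableType e)
    (R : realType) (g : T -> R) :
  (forall x, 0 <= g x) -> measurable_fun [set: T] g ->
  measurable_fun [set: T] (fun x => (g x)^-1).
Proof.
move=> g0 mg; under eq_fun do rewrite -powR_inv1//.
exact: measurableT_comp (measurable_powR (-1)) mg.
Qed.

(* The density with respect to [mu = g dx] of the translate by [a] of
   [1_F dmu], wherever [g] does not vanish; where it does, the value is the
   junk [0]. *)
Definition shift_weight (R : realType) (d : nat) (g : Rd R d -> R)
    (F : set (Rd R d)) (a y : Rd R d) : R :=
  let x := shift (- (a : 'rV_d) : Rd R d) y in \1_F x * g x * (g y)^-1.

Lemma shiftNK (R : realType) (d : nat) (a x : Rd R d) :
  shift (- (a : 'rV_d) : Rd R d) (shift a x) = x.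
Proof. by rewrite /shift addrK. Qed.

Lemma shift_weight_ge0 (R : realType) (d : nat) (g : Rd R d -> R)
    (F : set (Rd R d)) (a y : Rd R d) :
  (forall x, 0 <= g x) -> 0 <= shift_weight g F a y.
Proof. by move=> g0; rewrite !mulr_ge0// invr_ge0. Qed.

Lemma measurable_shift_weight (R : realType) (d : nat) (g : Rd R d -> R)
    (F : set (Rd R d)) (a : Rd R d) :
  (forall x, 0 <= g x) -> measurable_fun [set: Rd R d] g -> measurable F ->
  measurable_fun [set: Rd R d] (shift_weight g F a).
Proof.
move=> g0 mg mF; apply: measurable_funM; last exact: measurable_inv_ge0.
have ms := @measurable_shift R d (- (a : 'rV_d)).
apply: measurable_funM; last exact: measurableT_comp.
by apply: (@measurableT_comp _ _ _ _ _ _ (\1_F : _ -> R)).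
Qed.

(** Over [lam], the substitution [y = x + a] turns the left integral into the right one: the density
    [g y] cancels the [1 / g y] in the weight, since [g > 0] on [F + a]. *)
Lemma ge0_integral_shift_weight (R : realType) (d : nat)
    (lam mu : {measure set Rd R d -> \bar R}) (g : Rd R d -> R)
    (F : set (Rd R d)) (a : Rd R d) (f : Rd R d -> \bar R) :
  is_lebesgue_measure lam ->
  measurable_fun [set: Rd R d] g -> (forall x, 0 <= g x) ->
  (mu [set: Rd R d] < +oo)%E ->
  (forall E, measurable E -> mu E = (\int[lam]_(x in E) (g x)%:E)%E) ->
  measurable F -> (forall x, F x -> 0 < g (shift a x)) ->
  measurable_fun [set: Rd R d] f -> (forall x, 0 <= f x)%E ->
  (\int[mu]_y (f y * (shift_weight g F a y)%:E) =
   \int[mu]_x (f (shift a x) * (\1_F x)%:E))%E.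
Proof.
move=> hlam mg g0 mufin mu_g mF gF mf f0.
have dens := ge0_integral_density (lebesgue_sigma_finite hlam) mufin mg g0 mu_g.
have mw : measurable_fun [set: Rd R d] (EFin \o shift_weight g F a).
  by apply/measurable_EFinP; exact: measurable_shift_weight.
have w0 y : (0 <= (shift_weight g F a y)%:E)%E.
  by rewrite lee_fin shift_weight_ge0.
have mfa : measurable_fun [set: Rd R d] (f \o shift a).
  by apply: measurableT_comp => //; exact: measurable_shift.
rewrite !dens//; last 4 first.
- by apply: emeasurable_funM => //; exact/measurable_EFinP.
- by move=> x; rewrite mule_ge0// lee_fin.
- exact: emeasurable_funM.
- by move=> x; rewrite mule_ge0.
rewrite -(ge0_integral_shift a)//; last 2 first.
- by apply: emeasurable_funM; [exact: emeasurable_funM|exact/measurable_EFinP].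
- by move=> x; rewrite !mule_ge0// lee_fin.
apply: eq_integral => x _; rewrite -!muleA -!EFinM; congr (_ * _%:E)%E.
rewrite /shift_weight shiftNK indicE.
have [/set_mem Fx|_] := boolP (x \in F); last by rewrite !mul0r.
by rewrite !mul1r mulfVK// gt_eqF// gF.
Qed.

(** The nonnegative case applied to the positive and negative parts of [h], out of which the
    nonnegative weights factor. *)
Lemma Rintegral_shift_weight (R : realType) (d : nat)
    (lam mu : {measure set Rd R d -> \bar R}) (g : Rd R d -> R)
    (F : set (Rd R d)) (a : Rd R d) (h : Rd R d -> R) :
  is_lebesgue_measure lam ->
  measurable_fun [set: Rd R d] g -> (forall x, 0 <= g x) ->
  (mu [set: Rd R d] < +oo)%E ->
  (forall E, measurable E -> mu E = (\int[lam]_(x in E) (g x)%:E)%E) ->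
  measurable F -> (forall x, F x -> 0 < g (shift a x)) ->
  measurable_fun [set: Rd R d] h ->
  \int[mu]_y (shift_weight g F a y * h y) =
  \int[mu]_x (\1_F x * h (shift a x)).
Proof.
move=> hlam mg g0 mufin mu_g mF gF mh; congr fine.
have mE : measurable_fun [set: Rd R d] (EFin \o h) by exact/measurable_EFinP.
have posM (w k : Rd R d -> R) : (forall x, 0 <= w x) ->
    (fun x => (w x * k x)%:E)^\+%E = (fun x => ((EFin \o k)^\+ x * (w x)%:E)%E).
  move=> w0; apply/funext => x.
  rewrite muleC.
  have := congr1 (@^~ x) (ge0_funeposM (fun=> (k x)%:E) (w0 x)).
  by rewrite /= !funeposE.
have negM (w k : Rd R d -> R) : (forall x, 0 <= w x) ->
    (fun x => (w x * k x)%:E)^\-%E = (fun x => ((EFin \o k)^\- x * (w x)%:E)%E).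
  move=> w0; apply/funext => x.
  rewrite muleC.
  have := congr1 (@^~ x) (ge0_funenegM (fun=> (k x)%:E) (w0 x)).
  by rewrite /= !funenegE.
rewrite integralE [RHS]integralE.
have w0 y : 0 <= shift_weight g F a y by exact: shift_weight_ge0.
rewrite !posM// !negM//; congr (_ - _)%E.
- rewrite (ge0_integral_shift_weight (lam := lam))//; last first.
    exact: measurable_funepos.
  by apply: eq_integral => x _; rewrite !funeposE.
- rewrite (ge0_integral_shift_weight (lam := lam))//; last first.
    exact: measurable_funeneg.
  by apply: eq_integral => x _; rewrite !funenegE.
Qed.

(** * Fourier transform of the translate *)

Lemma dotRDr (R : realType) (d : nat) (t x y : 'rV[R]_d) :
  dotR t (x + y) = dotR t x + dotR t y.
Proof.
by rewrite /dotR -big_split; apply: eq_bigr => i _; rewrite mxE mulrDr.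
Qed.

(* Translating [f dmu] only multiplies its Fourier transform by a phase. *)
Lemma FT_shift_weight (R : realType) (d : nat)
    (lam mu : {measure set Rd R d -> \bar R}) (g : Rd R d -> R)
    (F : set (Rd R d)) (a : Rd R d) (t : 'rV[R]_d) :
  is_lebesgue_measure lam ->
  measurable_fun [set: Rd R d] g -> (forall x, 0 <= g x) ->
  (mu [set: Rd R d] < +oo)%E ->
  (forall E, measurable E -> mu E = (\int[lam]_(x in E) (g x)%:E)%E) ->
  measurable F -> (forall x, F x -> 0 < g (shift a x)) ->
  FT_re mu (shift_weight g F a) (cst 0) t ^+ 2 +
    FT_im mu (shift_weight g F a) (cst 0) t ^+ 2 =
  FT_re mu \1_F (cst 0) t ^+ 2 + FT_im mu \1_F (cst 0) t ^+ 2.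
Proof.
move=> hlam mg g0 mufin mu_g mF gF.
pose th (x : Rd R d) := 2 * pi * dotR t x.
have mth : measurable_fun [set: Rd R d] th.
  by apply: measurable_funM => //; exact: measurable_dotR.
have mcos : measurable_fun [set: Rd R d] (cos \o th).
  exact: measurableT_comp (continuous_measurable_fun (@continuous_cos R)) mth.
have msin : measurable_fun [set: Rd R d] (sin \o th).
  exact: measurableT_comp (continuous_measurable_fun (@continuous_sin R)) mth.
(* Bounded measurable functions are integrable for the finite measure [mu]; this justifies the
   linearity used below. *)
have im (k : Rd R d -> R) : measurable_fun [set: Rd R d] k ->
    (forall x, `|k x| <= 1) ->
    mu.-integrable setT (EFin \o (fun x => \1_F x * k x)).
  move=> mk k1; apply: measurable_bounded_integrable => //.
    by apply: measurable_funM.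
  exists 1; split; first by rewrite num_real.
  move=> M M1 x _ /=; rewrite normrM (le_trans _ (ltW M1))// mulr_ile1//.
  by rewrite indicE; case: (_ \in _); rewrite ?normr1 ?normr0.
have icos := im _ mcos (fun x => cos_max (th x)).
have isin := im _ msin (fun x => sin_max (th x)).
(* The transform of [1_F dmu] at [t] is [C - iS]; that of the translate is
   [exp(-i th(a)) (C - iS)]. *)
pose C := \int[mu]_x (\1_F x * cos (th x)).
pose S := \int[mu]_x (\1_F x * sin (th x)).
have re (u : Rd R d -> R) :
    FT_re mu u (cst 0) t = \int[mu]_x (u x * (cos \o th) x).
  by apply: eq_Rintegral => x _; rewrite mul0r addr0.
have im' (u : Rd R d -> R) :
    FT_im mu u (cst 0) t = \int[mu]_x (u x * (- sin (th x))).
  by apply: eq_Rintegral => x _; rewrite mul0r sub0r mulrN.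
have FTim1 : FT_im mu \1_F (cst 0) t = - S.
  rewrite im' -mulN1r -RintegralZl//; apply: eq_Rintegral => x _.
  by rewrite mulrN mulN1r.
have thD x : th (shift a x) = th x + th a by rewrite /th dotRDr mulrDr.
have FTre2 : FT_re mu (shift_weight g F a) (cst 0) t =
    cos (th a) * C - sin (th a) * S.
  rewrite re (Rintegral_shift_weight (lam := lam))//.
  rewrite -!RintegralZl// -RintegralB//.
  - by apply: eq_Rintegral => x _; rewrite /= thD cosD; ring.
  - exact: (integrableZl measurableT (cos (th a)) icos).
  - exact: (integrableZl measurableT (sin (th a)) isin).
have FTim2 : FT_im mu (shift_weight g F a) (cst 0) t =
    - cos (th a) * S - sin (th a) * C.
  rewrite im' (Rintegral_shift_weight (lam := lam))//; last first.
    exact: measurable_funN.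
  rewrite -!RintegralZl// -RintegralB//.
  - by apply: eq_Rintegral => x _; rewrite /= thD sinD; ring.
  - exact: (integrableZl measurableT (- cos (th a)) isin).
  - exact: (integrableZl measurableT (sin (th a)) icos).
rewrite FTre2 FTim2 FTim1 re -/C.
(* The squared modulus of the phase is isolated as a factor, which then equals 1. *)
transitivity ((cos (th a) ^+ 2 + sin (th a) ^+ 2) * (C ^+ 2 + S ^+ 2)).
  by ring.
by rewrite cos2Dsin2; ring.
Qed.

(** * Sets of positive measure and essential bounds *)

Lemma measurable_ltr_set (e : measure_display) (T : measurableType e)
    (R : realType) (f h : T -> R) :
  measurable_fun [set: T] f -> measurable_fun [set: T] h ->
  measurable [set x | f x < h x].
Proof.
move=> mf mh; have := measurable_fun_ltr mf mh.
by move=> /(_ measurableT [set true]); rewrite setTI; exact.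
Qed.

(** If [mu E] were [0], then [g] would vanish almost everywhere on [E], against [g > 0] on a set of
    positive [lam]-measure. *)
Lemma density_gt0 (e : measure_display) (T : measurableType e) (R : realType)
    (lam mu : {measure set T -> \bar R}) (g : T -> R) (E : set T) :
  measurable_fun [set: T] g ->
  (forall E, measurable E -> mu E = (\int[lam]_(x in E) (g x)%:E)%E) ->
  measurable E -> (forall x, E x -> 0 < g x) -> (0 < lam E)%E -> (0 < mu E)%E.
Proof.
move=> mg mu_g mE gE lamE; rewrite lt0e measure_ge0 andbT.
apply/negP => /eqP muE0.
have : (\int[lam]_(x in E) `|(g x)%:E| = 0)%E.
  rewrite -muE0 mu_g//; apply: eq_integral => x /set_mem Ex.
  by rewrite gee0_abs// lee_fin ltW// gE.
have mgE : measurable_fun E (EFin \o g).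
  exact/measurable_EFinP/measurable_funTS.
move=> /(ae_eq_integral_abs lam mE mgE) ae0.
suff : lam E = 0%E by apply/eqP; rewrite gt_eqF.
apply/negligibleP => //; apply: negligibleS ae0 => x Ex /= /(_ Ex) [g0].
by have := gE x Ex; rewrite g0 ltxx.
Qed.

(** The part of [E] where [g = 0] carries no [mu]-mass. Restricting to [g > 0] lets overlaps found
    with [lam] be transferred back to [mu]. *)
Lemma lebesgue_gt0_density (e : measure_display) (T : measurableType e)
    (R : realType) (lam mu : {measure set T -> \bar R}) (g : T -> R)
    (E : set T) :
  measurable_fun [set: T] g -> (forall x, 0 <= g x) ->
  (forall E, measurable E -> mu E = (\int[lam]_(x in E) (g x)%:E)%E) ->
  measurable E -> (0 < mu E)%E ->
  (0 < lam (E `&` [set x | (0 < g x)%R]))%E.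
Proof.
move=> mg g0 mu_g mE muE; rewrite lt0e measure_ge0 andbT.
apply/negP => /eqP lamE0; suff : mu E = 0%E by apply/eqP; rewrite gt_eqF.
have mpos : measurable [set x | 0 < g x].
  exact: (measurable_ltr_set (measurable_cst (0 : R)) mg).
have mEpos := measurableI _ _ mE mpos.
transitivity (mu (E `\` [set x | (0 < g x)%R])
    + mu (E `&` [set x | (0 < g x)%R]))%E.
  exact: measureDI.
rewrite !mu_g//; last exact: measurableD.
rewrite [X in (_ + X)%E]null_set_integral//; last first.
  exact/measurable_EFinP/measurable_funTS.
rewrite adde0; apply: integral0_eq => x [_ /negP]; rewrite -leNgt => gx.
by congr (_%:E); apply/eqP; rewrite eq_le gx g0.
Qed.

(** Were [{g > M}] null, [M] would be one of the nonnegative bounds whose infimum is [esssup].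
    [essinf_lt] is dual. *)
Lemma esssup_gt (R : realType) (d : nat) (mu : {measure set Rd R d -> \bar R})
    (g : Rd R d -> R) (M : R) :
  measurable_fun [set: Rd R d] g -> 0 <= M -> (M%:E < esssup mu g)%E ->
  (0 < mu [set x | (M < g x)%R])%E.
Proof.
move=> mg M0 Mg; rewrite lt0e measure_ge0 andbT; apply/negP => /eqP mu0.
move: Mg; rewrite ltNge => /negP; apply; apply: ereal_inf_lbound.
split; first by rewrite lee_fin.
exists [set x | M < g x]; split => //.
  exact: (measurable_ltr_set (measurable_cst M) mg).
by move=> x /=; rewrite lee_fin => /negP; rewrite -ltNge.
Qed.

Lemma essinf_lt (R : realType) (d : nat) (mu : {measure set Rd R d -> \bar R})
    (g : Rd R d -> R) (m : R) :
  measurable_fun [set: Rd R d] g -> 0 <= m -> (essinf mu g < m%:E)%E ->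
  (0 < mu [set x | (g x < m)%R])%E.
Proof.
move=> mg m0 mg'; rewrite lt0e measure_ge0 andbT; apply/negP => /eqP mu0.
move: mg'; rewrite ltNge => /negP; apply; apply: ereal_sup_ubound.
split; first by rewrite lee_fin.
exists [set x | g x < m]; split => //.
  exact: (measurable_ltr_set mg (measurable_cst m)).
by move=> x /=; rewrite lee_fin => /negP; rewrite -ltNge.
Qed.

Lemma essinf_ge0 (R : realType) (d : nat) (mu : {measure set Rd R d -> \bar R})
    (g : Rd R d -> R) : (forall x, 0 <= g x) -> (0 <= essinf mu g)%E.
Proof.
move=> g0; apply: ereal_sup_ubound; split=> //.
by apply: aeW => x; rewrite lee_fin.
Qed.

(** * Comparing the two frame inequalities *)

Lemma frame_bounds_shift (R : realType) (d : nat)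
    (lam mu nu : {measure set Rd R d -> \bar R}) (g : Rd R d -> R) (A B : R)
    (F : set (Rd R d)) (a : Rd R d) (m M : R) :
  is_lebesgue_measure lam ->
  measurable_fun [set: Rd R d] g -> (forall x, 0 <= g x) ->
  (mu [set: Rd R d] < +oo)%E ->
  (forall E, measurable E -> mu E = (\int[lam]_(x in E) (g x)%:E)%E) ->
  frame_measure mu nu A B -> measurable F -> (0 < mu F)%E ->
  0 <= m -> 0 < M -> (forall x, F x -> g x <= m /\ M <= g (shift a x)) ->
  A * M <= B * m.
Proof.
move=> hlam mg g0 mufin mu_g [A0 [B0 frame]] mF muF m0 M0 FmM.
have gF x : F x -> 0 < g (shift a x).
  by move=> /FmM[_]; exact: lt_le_trans.
pose w := shift_weight g F a.
have mw : measurable_fun setT w by exact: measurable_shift_weight.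
have w0 y : 0 <= w y by exact: shift_weight_ge0.
have muFfin : mu F \is a fin_num.
  rewrite ge0_fin_numE//; apply: le_lt_trans mufin.
  by apply: le_measure => //; rewrite inE.
have normF : (\int[mu]_x ((\1_F x) ^+ 2)%:E = mu F)%E.
  rewrite -[in RHS](setIT F) -integral_indic//; apply: eq_integral => x _.
  by rewrite indicE; case: (_ \in _); rewrite ?expr1n ?expr0n.
(* One factor [w] is absorbed by the change of variables; the other becomes [g x / g (x + a)], at
   most [m / M] on [F]. *)
have normw : (\int[mu]_x ((w x) ^+ 2)%:E <= (m / M)%:E * mu F)%E.
  under eq_integral do rewrite expr2 EFinM.
  rewrite (ge0_integral_shift_weight (lam := lam))//; last first.
    exact/measurable_EFinP.
  rewrite -[in leRHS](setIT F) -integral_indic//.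
  rewrite -ge0_integralZl//; last 2 first.
  - exact/measurable_EFinP.
  - by rewrite lee_fin divr_ge0// ltW.
  apply: ge0_le_integral => //.
  - by move=> x _; rewrite mule_ge0// lee_fin.
  - apply: emeasurable_funM; last exact/measurable_EFinP.
    apply/measurable_EFinP; apply: measurableT_comp mw _.
    exact: measurable_shift.
  - by apply: emeasurable_funM => //; exact/measurable_EFinP.
  - move=> x _; rewrite indicE.
    have [/set_mem Fx|_] := boolP (x \in F); last by rewrite !mule0.
    rewrite !mule1 lee_fin /w /shift_weight shiftNK indicE mem_set// mul1r.
    have [gm Mg] := FmM x Fx.
    by rewrite ler_pM// ?invr_ge0// lef_pV2// posrE gF.
have L2F : L2 mu \1_F.
  by split=> //; rewrite normF ltey_eq muFfin.
have L2w : L2 mu w.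
  by split=> //; apply: le_lt_trans normw _; rewrite ltey_eq fin_numM.
have L20 : L2 mu (cst 0).
  split=> //; under eq_integral do rewrite expr0n.
  by rewrite integral0.
have norm_cst0 (u : Rd R d -> R) :
    L2norm2 mu u (cst 0) = (\int[mu]_x ((u x) ^+ 2)%:E)%E.
  by apply: eq_integral => x _; rewrite expr0n addr0.
(* The lower bound is used for [1_F], the upper one for [w]; their middle terms coincide. *)
have /andP[lo _] := frame _ _ L2F L20.
have /andP[_ hi] := frame _ _ L2w L20.
have := le_trans lo; move=> /(_ (B%:E * L2norm2 mu w (cst 0%R))%E).
have -> : (\int[nu]_t (FT_re mu \1_F (cst 0) t ^+ 2 +
      FT_im mu \1_F (cst 0) t ^+ 2)%:E)%E =
    (\int[nu]_t (FT_re mu w (cst 0) t ^+ 2 + FT_im mu w (cst 0) t ^+ 2)%:E)%E.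
  apply: eq_integral => t _.
  by rewrite (FT_shift_weight (lam := lam) (g := g) (a := a) t).
move=> /(_ hi); rewrite !norm_cst0 normF => AB.
have {}AB : (A%:E * mu F <= B%:E * ((m / M)%:E * mu F))%E.
  by apply: le_trans AB _; rewrite lee_wpmul2l// lee_fin ltW.
(* [mu F] is finite and positive, so it cancels. *)
move: AB muF; rewrite -(fineK muFfin) -!EFinM lee_fin lte_fin mulrA => AB p.
by move: AB; rewrite ler_pM2r// mulrA ler_pdivlMr.
Qed.

(** * Degenerate essential bounds and the zero measure *)

(** Off a single null set [g] is below every [1 / (n + 1)], hence zero, so [mu = g dx] has no mass
    there either. *)
Lemma esssup_le0 (R : realType) (d : nat)
    (lam mu : {measure set Rd R d -> \bar R}) (g : Rd R d -> R) :
  measurable_fun [set: Rd R d] g ->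
  (forall x, 0 <= g x) ->
  (forall E, measurable E -> mu E = (\int[lam]_(x in E) (g x)%:E)%E) ->
  (esssup mu g <= 0)%E -> mu [set: Rd R d] = 0%E.
Proof.
move=> mg g0 mu_g sup0.
have [N [mN muN0 gN]] : {ae mu, forall x, forall n : nat, g x <= n.+1%:R^-1}.
  apply: ae_foralln => n.
  have /ereal_inf_lt[M [_ aeM] Mn] : (esssup mu g < (n.+1%:R^-1)%:E)%E.
    by apply: le_lt_trans sup0 _; rewrite lte_fin invr_gt0.
  apply: filterS aeM => x gx; rewrite -lee_fin.
  by apply: le_trans gx _; exact: ltW.
transitivity (mu (setT `\` N) + mu (setT `&` N))%E; first exact: measureDI.
rewrite setTI muN0 adde0 mu_g; last exact: measurableD.
apply: integral0_eq => x [_ /= Nx]; congr (_%:E); apply/eqP.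
rewrite eq_le g0 andbT leNgt; apply/negP => gx0; apply: Nx; apply: gN => /= h.
have := h (Num.truncn (g x)^-1); rewrite leNgt => /negP; apply.
by rewrite invf_plt ?posrE// truncnS_gt.
Qed.

(** Off a null set [g] would exceed every integer; as [g] is real-valued, that null set is the whole
    space. *)
Lemma essinf_pinfty (R : realType) (d : nat)
    (mu : {measure set Rd R d -> \bar R}) (g : Rd R d -> R) :
  essinf mu g = +oo%E -> mu [set: Rd R d] = 0%E.
Proof.
move=> inf_oo.
have [N [mN muN0 gN]] : {ae mu, forall x, forall n : nat, n%:R <= g x}.
  apply: ae_foralln => n.
  have /ereal_sup_gt[M [_ aeM] Mn] : (n%:R%:E < essinf mu g)%E.
    by rewrite inf_oo ltry.
  apply: filterS aeM => x gx; rewrite -lee_fin.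
  by apply: le_trans gx; exact: ltW.
apply/negligibleP => //; exists N; split => // x _; apply: gN => /= h.
by have := h (Num.truncn (g x)).+1; rewrite leNgt truncnS_gt.
Qed.

Lemma ae_measureT0 (R : realType) (d : nat)
    (mu : {measure set Rd R d -> \bar R}) (P : Rd R d -> Prop) :
  mu [set: Rd R d] = 0%E -> {ae mu, forall x, P x}.
Proof. by move=> mu0; exists setT; split. Qed.

Lemma esssup_measure0 (R : realType) (d : nat)
    (mu : {measure set Rd R d -> \bar R}) (g : Rd R d -> R) :
  mu [set: Rd R d] = 0%E -> (esssup mu g <= 0)%E.
Proof.
by move=> mu0; apply: ereal_inf_lbound; split=> //; exact: ae_measureT0.
Qed.

Lemma essinf_measure0 (R : realType) (d : nat)
    (mu : {measure set Rd R d -> \bar R}) (g : Rd R d -> R) :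
  mu [set: Rd R d] = 0%E -> essinf mu g = +oo%E.
Proof.
move=> mu0; apply/eqP; rewrite -leye_eq; apply: ereal_sup_ubound.
by split; [rewrite leey|exact: ae_measureT0].
Qed.

(** * From real thresholds to the essential bounds *)

Lemma frame_bounds_real (R : realType) (d : nat)
    (lam mu nu : {measure set Rd R d -> \bar R}) (g : Rd R d -> R)
    (A B m M : R) :
  is_lebesgue_measure lam ->
  measurable_fun [set: Rd R d] g -> (forall x, 0 <= g x) ->
  (mu [set: Rd R d] < +oo)%E ->
  (forall E, measurable E -> mu E = (\int[lam]_(x in E) (g x)%:E)%E) ->
  frame_measure mu nu A B -> 0 <= m -> 0 < M ->
  (essinf mu g < m%:E)%E -> (M%:E < esssup mu g)%E -> A * M <= B * m.
Proof.
move=> hlam mg g0 mufin mu_g frame m0 M0 inf_m sup_M.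
have mlow := measurable_ltr_set mg (measurable_cst m).
have mhigh := measurable_ltr_set (measurable_cst M) mg.
have mpos := measurable_ltr_set (measurable_cst (0 : R)) mg.
have lamhigh : (0 < lam [set x | (M < g x)%R])%E.
  have := lebesgue_gt0_density mg g0 mu_g mhigh (esssup_gt mg (ltW M0) sup_M).
  move=> /lt_le_trans; apply; apply: le_measure; rewrite ?inE//.
  exact: measurableI.
have lamlow := lebesgue_gt0_density mg g0 mu_g mlow (essinf_lt mg m0 inf_m).
have mlowpos := measurableI _ _ mlow mpos.
have [a lamF] := exists_shift_meets hlam mhigh mlowpos lamhigh lamlow.
have ms := @measurable_shift R d a measurableT _ mhigh; rewrite setTI in ms.
have mF := measurableI _ _ mlowpos ms.
apply: (frame_bounds_shift hlam mg g0 mufin mu_g frame mF _ m0 M0 (a := a)).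
  (* The overlap is positive for [lam]; since [g > 0] on it, it is positive for [mu] too. *)
  by apply: (density_gt0 mg mu_g mF _ lamF) => x [[_ ?] _].
by move=> x [[/= /ltW ? _] /ltW ?].
Qed.

Theorem theorem2p4 (R : realType) (d : nat)
    (lam : {measure set Rd R d -> \bar R}) (hlam : is_lebesgue_measure lam)
    (mu : {measure set Rd R d -> \bar R}) (g : Rd R d -> R)
    (g_meas : measurable_fun [set: Rd R d] g)
    (g_ge0 : forall x, 0 <= g x)
    (mu_fin : (mu [set: Rd R d] < +oo)%E)
    (mu_g : forall E : set (Rd R d), measurable E ->
       mu E = (\int[lam]_(x in E) (g x)%:E)%E) :
  (forall (nu : {measure set Rd R d -> \bar R}) (A B : R),
     frame_measure mu nu A B ->
     (A%:E * esssup mu g <= B%:E * essinf mu g)%E) /\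
  (esssup mu g = +oo%E \/ essinf mu g = (0%R)%:E ->
     forall (nu : {measure set Rd R d -> \bar R}) (A B : R),
       ~ frame_measure mu nu A B).
Proof.
(* The product form of the ratio bound stays meaningful when [essinf] is [0] or [+oo]. *)
have part1 (nu : {measure set Rd R d -> \bar R}) (A B : R) :
    frame_measure mu nu A B ->
    (A%:E * esssup mu g <= B%:E * essinf mu g)%E.
  move=> frame; have [A0 [B0 _]] := frame.
  have real_bound m M := frame_bounds_real (m := m) (M := M) hlam g_meas g_ge0
    mu_fin mu_g frame.
  have := essinf_ge0 mu g_ge0.
  case: (essinf mu g) real_bound => [i| |] real_bound //; last first.
    by move=> _; rewrite gt0_muley ?lte_fin// leey.
  rewrite lee_fin => i0.
  have bound (M : R) : 0 < M -> (M%:E < esssup mu g)%E -> M <= B * i / A.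
    move=> M0 ltM; rewrite ler_pdivlMr// mulrC.
    apply/ler_addgt0Pr => e e0.
    (* A threshold strictly above [essinf], chosen so that [B * m] is [B * i + e]. *)
    have := real_bound (i + e / B) M.
    rewrite mulrDr mulrCA divff ?gt_eqF// mulr1.
    apply=> //; first by rewrite addr_ge0// divr_ge0// ltW.
    by rewrite lte_fin ltrDl divr_gt0.
  have Bi0 : 0 <= B * i / A by rewrite !mulr_ge0// ?invr_ge0 ltW.
  suff : (esssup mu g <= (B * i / A)%:E)%E.
    move=> /(lee_wpmul2l (_ : (0 <= A%:E)%E)) => /(_ (ltW A0)) /le_trans; apply.
    by rewrite -!EFinM lee_fin mulrC divfK// gt_eqF.
  case: (esssup mu g) bound => [s| |] bound; rewrite ?leNye//.
    rewrite lee_fin leNgt; apply/negP => lts.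
    (* The midpoint lies strictly between the claimed bound and [s]. *)
    have := bound ((B * i / A + s) / 2); rewrite lte_fin.
    lra.
  by exfalso; have := bound (B * i / A + 1) _ (ltry _); lra.
split=> // degenerate nu A B frame.
have [A0 [B0 _]] := frame; have := part1 nu A B frame.
(* The zero measure has [esssup <= 0] and [essinf = +oo], so it is never degenerate. Below, either
   degenerate case combined with [part1] forces [mu] to be zero. *)
have mu0 : mu setT = 0%E -> esssup mu g = +oo%E \/ essinf mu g = 0%E -> False.
  move=> mu0 []; last by rewrite essinf_measure0.
  by move=> h; have := esssup_measure0 g mu0; rewrite h.
case: (degenerate) => h; rewrite h.
  rewrite gt0_muley ?lte_fin// leye_eq => /eqP.
  have := essinf_ge0 mu g_ge0.
  case E : (essinf mu g) => [i| |] // _ _.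
  exact: mu0 (essinf_pinfty E) degenerate.
rewrite mule0 pmule_rle0 ?lte_fin// => sup0.
exact: mu0 (esssup_le0 g_meas g_ge0 mu_g sup0) degenerate.
Qed.
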